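(* Let $F$ be a finitely generated, free non-abelian group. Let $g_1, \dots, g_r$ be a collection of elements of $F$. Then, for all but finitely many integers $n$, the group $F/\langle\langle g_1^n, \dots, g_r^n \rangle\rangle$ is large.
   Context: A group $G$ is large if some finite index subgroup of $G$ admits a surjective homomorphism onto a non-abelian free group. For elements $x_1,\dots,x_k$ of a group $G$, $\langle\langle x_1,\dots,x_k\rangle\rangle$ denotes the subgroup of $G$ normally generated by $x_1,\dots,x_k$ (the normal closure of $\{x_1,\dots,x_k\}$ in $G$). *)

(* Defs.v *)
From HB Require Import structures.
From mathcomp Require Import all_boot all_order ssralg ssrint.
From mathcomp Require Import generic_quotient.
From mathcomp Require Import boolp classical_sets functions cardinality.

Set Implicit Arguments.
Unset Strict Implicit.
Unset Printing Implicit Defensive.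

Local Open Scope classical_set_scope.
Local Open Scope group_scope.
Local Open Scope quotient_scope.

(* Integer powers, mirroring exprz for rings: Negz m stands for - m.+1. *)
Definition expgz (G : groupType) (x : G) (n : int) : G :=
  match n with Posz m => x ^+ m | Negz m => x ^- m.+1 end.

Definition abelian_group (G : groupType) : Prop := commutative (@mul G).

(* Subgroups of a possibly infinite G are boolean predicates of type
   groupClosed G; classically every subset of G is such a predicate. *)
Definition finitely_generated (G : groupType) : Prop :=
  exists s : seq G, forall H : groupClosed G,
    {subset s <= H} -> forall x : G, x \in H.

Definition left_coset (G : groupType) (H : groupClosed G) (x : G) : set G :=
  [set y | x^-1 * y \in H].

Definition finite_index (G : groupType) (H : groupClosed G) : Prop :=
  finite_set (range (left_coset H)).

Section SubgroupType.
Variables (G : groupType) (H : groupClosed G).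

Definition subg_type : Type := {x : G | x \in H}.

HB.instance Definition _ := SubChoice.on subg_type.

Lemma subg_closed : group_closed H.
Proof. by split; [exact: gpred1 | exact: gpredF]. Qed.

HB.instance Definition _ :=
  SubChoice_isSubGroup.Build G (mem H) subg_type subg_closed.

End SubgroupType.

(* Universal property of the free group on the subset X. *)
Definition free_on (F : groupType) (X : set F) : Prop :=
  forall (K : groupType) (f : F -> K),
    (exists phi : {multiplicative F -> K}, {in X, phi =1 f}) /\
    (forall phi psi : {multiplicative F -> K},
       {in X, phi =1 f} -> {in X, psi =1 f} -> phi =1 psi).

Definition free_group (F : groupType) : Prop := exists X : set F, free_on X.

Definition large (G : groupType) : Prop :=
  exists H : groupClosed G, finite_index H /\
  exists L : groupType, free_group L /\ ~ abelian_group L /\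
  exists phi : {multiplicative subg_type H -> L}, set_surj setT setT phi.

Definition normal_in (G : groupType) (N : groupClosed G) : Prop :=
  forall x y : G, x \in N -> x ^ y \in N.

Record normal_subgroup (G : groupType) := NormalSubgroup {
  normal_pred :> groupClosed G;
  normal_predJ : normal_in normal_pred }.

Section NormalClosure.
Variables (G : groupType) (S : set G).

Definition ncl : {pred G} := fun x =>
  `[< forall N : groupClosed G, normal_in N -> (forall s, S s -> s \in N) ->
      x \in N >].

Lemma nclP (x : G) :
  reflect (forall N : groupClosed G, normal_in N ->
             (forall s, S s -> s \in N) -> x \in N)
          (x \in ncl).
Proof. exact: asboolP. Qed.

Lemma ncl_mul : mulg_closed ncl.
Proof.
move=> x y /nclP xN /nclP yN; apply/nclP => N nN SN.
by apply: gpredM; [exact: xN | exact: yN].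
Qed.

Lemma ncl_one : 1 \in ncl.
Proof. by apply/nclP => N _ _; exact: gpred1. Qed.

Lemma ncl_inv : invg_closed ncl.
Proof.
by move=> x /nclP xN; apply/nclP => N nN SN; rewrite gpredV; exact: xN.
Qed.

HB.instance Definition _ := isMulClosed.Build G ncl ncl_mul.
HB.instance Definition _ := isMul1Closed.Build G ncl ncl_one.
HB.instance Definition _ := isInvClosed.Build G ncl ncl_inv.

Lemma ncl_normal : normal_in ncl.
Proof.
move=> x y /nclP xN; apply/nclP => N nN SN.
by apply: (nN x y); exact: xN.
Qed.

Definition normal_closure : normal_subgroup G := NormalSubgroup ncl_normal.

End NormalClosure.

Section Quotient.
Variables (G : groupType) (N : normal_subgroup G).

Definition quotg_rel : rel G := fun x y => x^-1 * y \in normal_pred N.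

Lemma quotg_rel_refl : reflexive quotg_rel.
Proof. by move=> x; rewrite /quotg_rel mulVg gpred1. Qed.

Lemma quotg_rel_sym : symmetric quotg_rel.
Proof. by move=> x y; rewrite /quotg_rel -[LHS]gpredV invgM invgK. Qed.

Lemma quotg_rel_trans : transitive quotg_rel.
Proof.
move=> y x z xy yz; rewrite /quotg_rel.
by rewrite -(mulVKg y z) mulgA; apply: gpredM.
Qed.

Canonical quotg_equiv :=
  EquivRel quotg_rel quotg_rel_refl quotg_rel_sym quotg_rel_trans.

Definition quotg : Type := {eq_quot quotg_rel}.

HB.instance Definition _ := Choice.on quotg.
HB.instance Definition _ := EqQuotient.on quotg.

Definition quotg_one : quotg := \pi_quotg 1.
Definition quotg_mul (a b : quotg) : quotg := \pi_quotg (repr a * repr b).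
Definition quotg_inv (a : quotg) : quotg := \pi_quotg (repr a)^-1.

Lemma quotg_piP (x y : G) :
  \pi_quotg x = \pi_quotg y <-> x^-1 * y \in normal_pred N.
Proof. by split=> [/eqmodP|?]; [|apply/eqmodP]. Qed.

Lemma quotg_mul_pi (x y : G) :
  quotg_mul (\pi_quotg x) (\pi_quotg y) = \pi_quotg (x * y).
Proof.
apply/quotg_piP.
have /quotg_piP xr : \pi_quotg (repr (\pi_quotg x)) = \pi_quotg x.
  by rewrite reprK.
have /quotg_piP yr : \pi_quotg (repr (\pi_quotg y)) = \pi_quotg y.
  by rewrite reprK.
set x' := repr _ in xr *; set y' := repr _ in yr *.
have -> : (x' * y')^-1 * (x * y) = (x'^-1 * x) ^ y' * (y'^-1 * y).
  by rewrite /conjg invgM !mulgA mulgK.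
by apply: gpredM => //; apply: normal_predJ.
Qed.

Lemma quotg_inv_pi (x : G) : quotg_inv (\pi_quotg x) = \pi_quotg x^-1.
Proof.
apply/quotg_piP.
have /quotg_piP xr : \pi_quotg (repr (\pi_quotg x)) = \pi_quotg x.
  by rewrite reprK.
set x' := repr _ in xr *.
have -> : (x'^-1)^-1 * x^-1 = ((x'^-1 * x)^-1) ^ (x'^-1).
  by rewrite /conjg invgM !invgK !mulgA mulgK.
by apply: (@normal_predJ _ N (x'^-1 * x)^-1 x'^-1); rewrite gpredV.
Qed.

Lemma quotg_mulA : associative quotg_mul.
Proof.
elim/quotW=> x; elim/quotW=> y; elim/quotW=> z.
by rewrite (quotg_mul_pi x y) (quotg_mul_pi y z) 2!quotg_mul_pi mulgA.
Qed.

Lemma quotg_mul1g : left_id quotg_one quotg_mul.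
Proof.
by elim/quotW=> x; rewrite /quotg_one quotg_mul_pi mul1g.
Qed.

Lemma quotg_mulg1 : right_id quotg_one quotg_mul.
Proof.
by elim/quotW=> x; rewrite /quotg_one quotg_mul_pi mulg1.
Qed.

Lemma quotg_mulVg : left_inverse quotg_one quotg_inv quotg_mul.
Proof.
by elim/quotW=> x; rewrite quotg_inv_pi quotg_mul_pi mulVg.
Qed.

Lemma quotg_mulgV : right_inverse quotg_one quotg_inv quotg_mul.
Proof.
by elim/quotW=> x; rewrite quotg_inv_pi quotg_mul_pi mulgV.
Qed.

HB.instance Definition _ :=
  isGroup.Build quotg quotg_mulA quotg_mul1g quotg_mulg1 quotg_mulVg quotg_mulgV.

Definition quotg_pi (x : G) : quotg := \pi_quotg x.

Lemma quotg_piM : {morph quotg_pi : x y / x * y}.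
Proof. by move=> x y; rewrite /quotg_pi -quotg_mul_pi. Qed.

HB.instance Definition _ := isMultiplicative.Build G quotg quotg_pi quotg_piM.

End Quotient.

(* Main.v *)
Require Import Defs.
From HB Require Import structures.
From mathcomp Require Import all_boot fingroup gproduct.
From mathcomp Require Import ssralg finalg ssrnum ssrint zmodp matrix intdiv.
From mathcomp Require Import zify.
From mathcomp Require Import boolp classical_sets functions cardinality.

(** The strategy is that of Olshanskii and Osin: pass to a finite-index subgroup
    in which the relators are few compared with the generators, then apply the
    theorem of Baumslag and Pride that a group with at least two more generators
    than relators is large.

    Two noncommuting elements of a basis of [F] generate a free retract [L] of
    rank two.  The quotient of [F] by the powers [g_i^n] maps onto the quotient
    of [L] by the powers of the images of the [g_i], and largeness lifts along
    surjections, so [F] may be replaced by [L]; the [g_i] of trivial image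
    impose nothing.

    Let [g] be a nontrivial element of [L], with [m] syllables.  It acts
    nontrivially in a unitriangular representation of size [m + 1], in which
    each generator is 1 plus a sum of superdiagonal matrix units.  Modulo
    [D = n / gcd (n, m!)] every unitriangular matrix satisfies [T^n = 1],
    because [D] divides the binomials [C(n, i)] with [0 < i <= m], while the
    order of the image of [g] tends to infinity with [n], because [D >= n / m!]
    does.  So for all large [n] there is a finite quotient [Q] of [L] of
    exponent dividing [n] in which every [g_i] has order more than twice the
    number of the [g_i] ([finite_quotient_large_orders]).

    The kernel of [L -> Q] is generated by the [2 |Q|] edges of the Cayley graph
    of [Q], subject to [|Q| - 1] relators that trivialise chosen paths from the
    identity to the other vertices.  The conjugates of [g_i^n] add one relator
    for each coset of the cyclic group generated by [g_i] in [Q], and together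
    these are fewer than [|Q|].  At least two generators remain in excess
    ([powers_killed_onto_large]).

    It remains to see that a group [P] with generators [I] and relators [R],
    where [|R| + 2 <= |I|], is large ([deficiency_two_large]).  By linear algebra
    there is a surjection [lam : P -> Z].  In the subgroup [lam^-1 (M Z)] the
    relators become loops in a graph that winds around a circle of length [M].
    Cut the circle at one point, label the edges that cross the cut by powers of
    a letter [a], and the edges far from the cut by powers [b^c] of a second
    letter, where the exponents [c] solve the linear system that says that all
    relator loops have trivial label.  Once [M] is large this system has more
    unknowns than equations, since the number of edges suppressed near the cut
    does not grow with [M]; a primitive solution [c] gives a map onto the free
    group on [a] and [b].

    Subgroups of finite index never appear through presentations of their own.
    A homomorphism to the wreath product [K wr Q] restricts to a homomorphism
    to [K] on the subgroup that maps trivially to [Q] ([large_wreath]), and a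
    homomorphism from a free group to [K wr Q] is an arbitrary labelling by
    elements of [K] of the edges of a graph with vertex set [Q]. *)

Set Implicit Arguments.
Unset Strict Implicit.
Unset Printing Implicit Defensive.

Import GRing.Theory Num.Theory FinRing.Theory.

Local Open Scope classical_set_scope.
Local Open Scope group_scope.

(** * Words, subgroups and powers *)

Section PlainMorphisms.
Variables (G K : groupType) (phi : G -> K).
Hypothesis phiM : {morph phi : x y / x * y}.

Lemma morph_one : phi 1 = 1.
Proof. by apply: (mulgI (phi 1)); rewrite -phiM !mulg1. Qed.

Lemma morph_inv x : phi x^-1 = (phi x)^-1.
Proof. by apply: (mulgI (phi x)); rewrite -phiM !mulgV morph_one. Qed.

Lemma morph_exp x n : phi (x ^+ n) = phi x ^+ n.
Proof.
by elim: n => [|n IH]; rewrite ?expg0 ?morph_one // !expgS phiM IH.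
Qed.

Lemma morph_pack : exists psi : {multiplicative G -> K}, psi =1 phi.
Proof.
pose m := isMultiplicative.Build G K phi phiM.
pose psi : {multiplicative G -> K} := HB.pack phi m.
by exists psi.
Qed.

End PlainMorphisms.

Lemma subg_valM (G : groupType) (H : groupClosed G) (x y : subg_type H) :
  val (x * y) = val x * val y.
Proof. exact: gmulfM. Qed.

Section Words.
Variable I : Type.
Implicit Types (w : seq (I * bool)).

Definition eval_letter (G : groupType) (f : I -> G) (x : I * bool) : G :=
  if x.2 then f x.1 else (f x.1)^-1.

Definition eval (G : groupType) (f : I -> G) w : G :=
  \prod_(x <- w) eval_letter f x.

Definition word_inv w := [seq (x.1, ~~ x.2) | x <- rev w].

Variable G : groupType.
Implicit Types f : I -> G.

Lemma eval_nil f : eval f [::] = 1.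
Proof. by rewrite /eval big_nil. Qed.

Lemma eval_cons f x w : eval f (x :: w) = eval_letter f x * eval f w.
Proof. by rewrite /eval big_cons. Qed.

Lemma eval_cat f w1 w2 : eval f (w1 ++ w2) = eval f w1 * eval f w2.
Proof. by rewrite /eval big_cat. Qed.

Lemma eval_seq1 f i : eval f [:: (i, true)] = f i.
Proof. by rewrite eval_cons eval_nil mulg1. Qed.

Lemma eval_word_inv f w : eval f (word_inv w) = (eval f w)^-1.
Proof.
elim: w => [|[i b] w IH]; first by rewrite /word_inv /= eval_nil invg1.
rewrite /word_inv rev_cons map_rcons -cats1 eval_cat -/(word_inv w) IH.
rewrite eval_cons eval_cons eval_nil mulg1 invgM; congr (_ * _).
by case: b; rewrite /eval_letter //= invgK.
Qed.

Lemma eval_nseq f w n : eval f (flatten (nseq n w)) = eval f w ^+ n.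
Proof.
elim: n => [|n IH]; first by rewrite eval_nil expg0.
by rewrite /= eval_cat IH expgS.
Qed.

Lemma eval_morph (K : groupType) (phi : G -> K) f w :
    {morph phi : x y / x * y} ->
  phi (eval f w) = eval (phi \o f) w.
Proof.
move=> phiM; rewrite /eval (big_morph phi phiM (morph_one phiM)).
by apply: eq_bigr => -[i [|]] _ //; rewrite /eval_letter /= morph_inv.
Qed.

Lemma eval_ext f f' w : f =1 f' -> eval f w = eval f' w.
Proof.
by move=> ff'; apply: eq_bigr => -[i b] _; rewrite /eval_letter /= ff'.
Qed.

End Words.

Section SubgroupOf.
Variables (G : groupType) (P : G -> Prop).
Hypotheses (P1 : P 1) (PM : forall x y, P x -> P y -> P (x * y)).
Hypothesis PV : forall x, P x -> P x^-1.

(** The closure proofs are arguments of the predicate so that its structure of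
    closed predicate is found by unification. *)
Definition subgroup_pred of P 1 & (forall x y, P x -> P y -> P (x * y))
  & (forall x, P x -> P x^-1) : {pred G} := fun x => `[< P x >].

Let S := subgroup_pred P1 PM PV.

Fact subgroup_pred_mul : mulg_closed S.
Proof. by move=> x y /asboolP Px /asboolP Py; apply/asboolP; apply: PM. Qed.

Fact subgroup_pred_one : 1 \in S.
Proof. exact/asboolP. Qed.

Fact subgroup_pred_inv : invg_closed S.
Proof. by move=> x /asboolP Px; apply/asboolP; apply: PV. Qed.

HB.instance Definition _ := isMulClosed.Build G S subgroup_pred_mul.
HB.instance Definition _ := isMul1Closed.Build G S subgroup_pred_one.
HB.instance Definition _ := isInvClosed.Build G S subgroup_pred_inv.

Definition subgroup_of : groupClosed G := S.

Lemma subgroup_ofP x : reflect (P x) (x \in subgroup_of).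
Proof. exact: asboolP. Qed.

End SubgroupOf.

Section Generated.
Variables (G : groupType) (I : Type) (f : I -> G).

Definition word_value (x : G) : Prop := exists w, x = eval f w.

Fact word_value1 : word_value 1.
Proof. by exists [::]; rewrite eval_nil. Qed.

Fact word_valueM x y : word_value x -> word_value y -> word_value (x * y).
Proof. by move=> [u ->] [v ->]; exists (u ++ v); rewrite eval_cat. Qed.

Fact word_valueV x : word_value x -> word_value x^-1.
Proof. by move=> [u ->]; exists (word_inv u); rewrite eval_word_inv. Qed.

Definition words_subgroup : groupClosed G :=
  subgroup_of word_value1 word_valueM word_valueV.

Lemma words_gen_in i : f i \in words_subgroup.
Proof. by apply/subgroup_ofP; exists [:: (i, true)]; rewrite eval_seq1. Qed.

Definition words_gen i : subg_type words_subgroup := Sub (f i) (words_gen_in i).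

Lemma val_eval_words_gen w : val (eval words_gen w) = eval f w.
Proof.
by rewrite (eval_morph _ _ (@subg_valM _ _)); apply: eval_ext.
Qed.

Lemma words_genP (x : subg_type words_subgroup) : exists w, x = eval words_gen w.
Proof.
have /subgroup_ofP[w xw] := valP x.
by exists w; apply: val_inj; rewrite val_eval_words_gen.
Qed.

End Generated.

Section IntegerPowers.
Variable G : groupType.
Implicit Types (x : G) (m n : int).

Lemma expgz1 x : expgz x 1 = x.
Proof. by []. Qed.

Lemma expgzS x n : expgz x (1 + n)%R = x * expgz x n.
Proof.
case: n => [n|[|n]]; first by rewrite -PoszD add1n /= expgS.
  by rewrite /= expg1 mulgV.
have -> : (1 + Negz n.+1 = Negz n)%R by rewrite !NegzE -[n.+2]add1n PoszD; lia.
by rewrite /= (expgSr x n.+1) invgM mulVKg.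
Qed.

Lemma expgzD x m n : expgz x (m + n)%R = expgz x m * expgz x n.
Proof.
elim/int_rect: m => [|m IH|m IH]; first by rewrite add0r mul1g.
  by rewrite -add1n PoszD -addrA !expgzS IH mulgA.
apply: (mulgI x); rewrite mulgA -!expgzS addrA.
by have -> : (1 - m.+1%:Z = - m%:Z)%R by lia.
Qed.

Lemma expgzN x n : expgz x (- n)%R = (expgz x n)^-1.
Proof. by apply: (mulgI (expgz x n)); rewrite -expgzD subrr mulgV. Qed.

Lemma expgz_morph (K : groupType) (phi : G -> K) x n :
  {morph phi : x y / x * y} -> phi (expgz x n) = expgz (phi x) n.
Proof.
by move=> phiM; case: n => n /=; rewrite ?(morph_inv phiM) (morph_exp phiM).
Qed.

Lemma expgz_abs x n : expgz x n = 1 <-> x ^+ absz n = 1.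
Proof.
case: n => n //=; split => [/eqP|->]; last by rewrite invg1.
by rewrite invg_eq1 => /eqP.
Qed.

End IntegerPowers.

(** * Wreath products and largeness *)

Section Wreath.
Variables (K : groupType) (Q : finGroupType).

(** [Q] acts on the base group [Q -> K] by right translation of the argument, so
    the first component of a product collects labels along a path in [Q]. *)
Definition wreath : Type := ({ffun Q -> K} * Q)%type.

HB.instance Definition _ := Choice.copy wreath ({ffun Q -> K} * Q)%type.

Implicit Types x y z : wreath.

Definition wreath_one : wreath := ([ffun=> 1], 1).
Definition wreath_mul x y : wreath :=
  ([ffun v : Q => x.1 v * y.1 (v * x.2)], x.2 * y.2).
Definition wreath_inv x : wreath := ([ffun v : Q => (x.1 (v / x.2))^-1], x.2^-1).

Lemma wreath_eqP x y : x.1 =1 y.1 -> x.2 = y.2 -> x = y.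
Proof. by case: x y => [f p] [g q] /= /ffunP-> ->. Qed.

Fact wreath_mulA : associative wreath_mul.
Proof.
move=> x y z; apply: wreath_eqP => [v|] /=; last by rewrite mulgA.
by rewrite !ffunE /= !mulgA.
Qed.

Fact wreath_mul1 : left_id wreath_one wreath_mul.
Proof.
move=> x; apply: wreath_eqP => [v|] /=; last by rewrite mul1g.
by rewrite !ffunE mulg1 mul1g.
Qed.

Fact wreath_mulr1 : right_id wreath_one wreath_mul.
Proof.
move=> x; apply: wreath_eqP => [v|] /=; last by rewrite mulg1.
by rewrite !ffunE mulg1.
Qed.

Fact wreath_mulV : left_inverse wreath_one wreath_inv wreath_mul.
Proof.
move=> x; apply: wreath_eqP => [v|] /=; last by rewrite mulVg.
by rewrite !ffunE mulVg.
Qed.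

Fact wreath_mulrV : right_inverse wreath_one wreath_inv wreath_mul.
Proof.
move=> x; apply: wreath_eqP => [v|] /=; last by rewrite mulgV.
by rewrite !ffunE mulgK mulgV.
Qed.

HB.instance Definition _ := isGroup.Build wreath
  wreath_mulA wreath_mul1 wreath_mulr1 wreath_mulV wreath_mulrV.

Lemma wreath_mul1E x y v : (x * y).1 v = x.1 v * y.1 (v * x.2).
Proof. by rewrite ffunE. Qed.

Lemma wreath_inv1E x v : (x^-1).1 v = (x.1 (v / x.2))^-1.
Proof. by rewrite ffunE. Qed.

Lemma wreath_mul2E x y : (x * y).2 = x.2 * y.2.
Proof. by []. Qed.

Lemma wreath_inv2E x : (x^-1).2 = x.2^-1.
Proof. by []. Qed.

Lemma wreath_exp2E x n : (x ^+ n).2 = x.2 ^+ n.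
Proof. exact: (morph_exp (phi := snd : wreath -> Q) wreath_mul2E). Qed.

Variables (I : Type) (s : I -> Q).

(** Starting from [v], a word in the generators traces a path in the Cayley graph
    of [Q] with respect to [s]; the edge [(i, v)] leads from [v] to [v * s i]. *)
Fixpoint lift_word (v : Q) (w : seq (I * bool)) : seq ((I * Q) * bool) :=
  match w with
  | [::] => [::]
  | (i, true) :: w' => ((i, v), true) :: lift_word (v * s i) w'
  | (i, false) :: w' => ((i, v / s i), false) :: lift_word (v / s i) w'
  end.

Definition wreath_gen (f : I * Q -> K) (i : I) : wreath :=
  ([ffun v : Q => f (i, v)], s i).

Lemma eval_wreath2 f w : (eval (wreath_gen f) w).2 = eval s w.
Proof.
exact: (eval_morph (phi := snd : wreath -> Q) (wreath_gen f) w wreath_mul2E).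
Qed.

Lemma eval_lift_word f v w : eval f (lift_word v w) = (eval (wreath_gen f) w).1 v.
Proof.
elim: w v => [|[i [|]] w IH] v /=; first by rewrite !eval_nil ffunE.
  by rewrite !eval_cons wreath_mul1E -IH /eval_letter /= ffunE.
by rewrite !eval_cons wreath_mul1E -IH /eval_letter /= !ffunE.
Qed.

End Wreath.

(** Elements mapping to 1 in [Q] form a subgroup of finite index on which the
    coordinate at 1 is a homomorphism; the subgroup of [L] that witnesses
    largeness is pulled back along it.  The coset of [x] is determined by the
    image of [x] in [Q] and by one coset in [L], which bounds the index. *)
Lemma large_wreath (L G : groupType) (Q : finGroupType) (rho : G -> wreath L Q) :
    {morph rho : x y / x * y} ->
    (forall z, exists x, (rho x).2 = 1 /\ (rho x).1 1 = z) ->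
  large L -> large G.
Proof.
move=> rhoM rho_surj [H [H_fin [M [M_free [M_nab [phi phi_surj]]]]]].
pose P (x : G) := (rho x).2 = 1 /\ (rho x).1 1 \in H.
have P1 : P 1 by rewrite /P morph_one //= ffunE gpred1.
have PM x y : P x -> P y -> P (x * y).
  move=> [x2 x1] [y2 y1]; split; first by rewrite rhoM /= x2 y2 mulg1.
  by rewrite rhoM wreath_mul1E x2 mulg1 gpredM.
have PV x : P x -> P x^-1.
  move=> [x2 x1]; split; first by rewrite morph_inv //= x2 invg1.
  by rewrite morph_inv // wreath_inv1E x2 mulgV gpredV.
pose HG := subgroup_of P1 PM PV.
exists HG; split.
  pose theta x := ((rho x).2, left_coset H ((rho x).1 (rho x).2^-1)).
  have theta_coset x y : theta x = theta y -> x^-1 * y \in HG.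
    move=> [xy2]; rewrite -xy2 => xy1; apply/subgroup_ofP; split.
      by rewrite rhoM morph_inv //= xy2 mulVg.
    rewrite rhoM morph_inv // wreath_mul1E wreath_inv1E /= !mul1g.
    have: left_coset H ((rho y).1 (rho x).2^-1) ((rho y).1 (rho x).2^-1).
      by rewrite /left_coset /= mulVg gpred1.
    by rewrite -xy1.
  have fin_theta : finite_set (range theta).
    apply: (@sub_finite_set _ _ ([set: Q] `*` range (left_coset H))).
      by move=> _ [x _ <-]; split=> //=; exists ((rho x).1 (rho x).2^-1).
    by apply: finite_setX => //; exact: finite_finset.
  pose psi (t : Q * set L) : set G :=
    [set y | exists2 x, theta x = t & x^-1 * y \in HG].
  apply: (sub_finite_set (B := psi @` range theta)); last exact: finite_image.
  move=> _ [x _ <-]; exists (theta x); first by exists x.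
  apply/seteqP; split=> y; last by exists x.
  move=> [x' /theta_coset xx' x'y].
  rewrite /left_coset /= -(mulVKg x' y) mulgA; apply: gpredM => //.
  by rewrite -gpredV invgM invgK.
exists M; split=> //; split=> //.
have inH (x : subg_type HG) : (rho (val x)).1 1 \in H.
  by have /subgroup_ofP[] := valP x.
have [psi psiE] : exists psi : {multiplicative subg_type HG -> M},
    psi =1 fun x => phi (Sub ((rho (val x)).1 1) (inH x)).
  apply: morph_pack => x y; rewrite -gmulfM; congr (phi _).
  apply: val_inj; apply: etrans (esym (subg_valM _ _)).
  rewrite !SubK.
  apply: (etrans (congr1 (fun g => (rho g).1 1) (subg_valM x y))).
  rewrite rhoM wreath_mul1E.
  by have /subgroup_ofP[-> _] := valP x; rewrite mulg1.
exists psi => m _; have [h _ <-] := phi_surj m I.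
have [x [x2 x1]] := rho_surj (val h).
have xH : x \in HG by apply/subgroup_ofP; split; rewrite // x1 (valP h).
exists (Sub x xH) => //; rewrite psiE; congr (phi _).
by apply: val_inj; rewrite SubK x1.
Qed.

Lemma free_large (L : groupType) : free_group L -> ~ abelian_group L -> large L.
Proof.
move=> L_free L_nab.
pose H : groupClosed L :=
  @subgroup_of L (fun=> True) I (fun _ _ _ _ => I) (fun _ _ => I).
have inH x : x \in H by apply/subgroup_ofP.
exists H; split.
  apply: (sub_finite_set (B := [set setT])) => // _ [x _ <-].
  by apply/seteqP; split=> y _ //=; exact: inH.
exists L; split=> //; split=> //; exists val => x _.
by exists (Sub x (inH x)) => //; rewrite SubK.
Qed.

(** * Integral linear systems *)

Section ExponentSums.
Local Open Scope ring_scope.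

Section Def.
Variable J : Type.
Implicit Types (c : J -> int) (w : seq (J * bool)).

Definition expsum c w : int := \sum_(x <- w) (if x.2 then c x.1 else - c x.1).

Lemma expsum_cat c w1 w2 : expsum c (w1 ++ w2) = expsum c w1 + expsum c w2.
Proof. by rewrite /expsum big_cat. Qed.

Lemma expsum_cons c x w :
  expsum c (x :: w) = (if x.2 then c x.1 else - c x.1) + expsum c w.
Proof. by rewrite /expsum big_cons. Qed.

Lemma expsum_nil c : expsum c [::] = 0.
Proof. by rewrite /expsum big_nil. Qed.

Definition power_word (x : J) (e : int) : seq (J * bool) :=
  nseq `|e| (x, 0 <= e).

Lemma expsum_power_word c x e : expsum c (power_word x e) = e * c x.
Proof.
have nseqE n b : expsum c (nseq n (x, b)) = (if b then c x else - c x) *+ n.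
  elim: n => [|n IH]; first by rewrite expsum_nil mulr0n.
  by rewrite /= expsum_cons IH mulrS.
rewrite nseqE; case: e => n /=; first by rewrite -mulr_natl natz.
by rewrite NegzE -mulr_natl natz mulrN mulNr.
Qed.

End Def.

Lemma expsum_delta (J : finType) (c : J -> int) w :
  expsum c w = \sum_j expsum (fun x => (x == j)%:R) w * c j.
Proof.
rewrite [LHS]/expsum; under [RHS]eq_bigr do rewrite /expsum mulr_suml.
rewrite exchange_big /=; apply: eq_bigr => -[x b] _ /=.
rewrite (bigD1 x) //= eqxx big1 => [|j /negPf jx].
  by rewrite addr0; case: b; rewrite ?mulN1r ?mul1r.
by rewrite eq_sym jx; case: b; rewrite ?oppr0 mul0r.
Qed.

(** In the Smith form [L D R] of the matrix of the system the last column of [D]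
    vanishes, there being more columns than rows.  The last column of the inverse
    of [R] is therefore a solution, and the last row of [R] pairs with it to 1. *)
Lemma primitive_solution (J : finType) (E : seq (seq (J * bool))) :
    (size E < #|J|)%N ->
  exists2 c : J -> int, {in E, forall w, expsum c w = 0}
                      & exists u, expsum c u = 1.
Proof.
move=> ltEJ.
pose A := \matrix_(i < size E, j < #|J|)
  expsum (fun x => (x == enum_val j)%:R) (nth [::] E i).
have [L Lu [R Ru [d _ AE]]] := int_Smith_normal_form A.
pose j0 : 'I_#|J| := Ordinal ltEJ.
pose c x := invmx R (enum_rank x) j0.
have AR0 i : (A *m invmx R) i j0 = 0.
  rewrite AE -mulmxA mulmxV // mulmx1 mxE big1 // => k _.
  by rewrite [in X in _ * X]mxE ltn_eqF ?mulr0n ?mulr0 //.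
exists c => [w /(nthP [::])[i lti <-]|].
  rewrite -[RHS](AR0 (Ordinal lti)) mxE expsum_delta (reindex (@enum_val J J)) /=.
    by apply: eq_bigr => j _; rewrite mxE /c enum_valK.
  exact: onW_bij (enum_val_bij J).
exists (flatten [seq power_word (enum_val j) (R j0 j) | j <- enum 'I_#|J|]).
have flattenE s : expsum c (flatten [seq power_word (enum_val j) (R j0 j) | j <- s])
    = \sum_(j <- s) R j0 j * invmx R j j0.
  elim: s => [|j s IH]; first by rewrite big_nil expsum_nil.
  by rewrite /= expsum_cat IH big_cons expsum_power_word /c enum_valK.
rewrite flattenE big_enum /=.
have : (R *m invmx R) j0 j0 = 1 by rewrite mulmxV // mxE eqxx.
by rewrite mxE.
Qed.

End ExponentSums.

(** * Presentations of deficiency two *)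

Section Presentation.
Variables (L : groupType) (ab : bool -> L).
Local Notation a := (ab true).
Local Notation b := (ab false).

Section CyclicCover.
Variables (I : finType) (lam : I -> int) (m : nat).
Notation M := (m.+2).
Implicit Types (w : seq (I * bool)) (p : int) (l : 'I_M).

(** The circle of length [M] is the cyclic group ['I_M], of which the integer line
    is the universal cover. *)
Definition height p : 'I_M := (p%:~R)%R.

Lemma heightD p q : (height p * height q)%g = height (p + q)%R.
Proof. by rewrite /height zmodMgE intrD. Qed.

Lemma heightV p : (height p)^-1%g = height (- p)%R.
Proof. by rewrite /height zmodVgE rmorphN. Qed.

Let val_nat k : nat_of_ord (k%:R : 'I_M)%R = k %% M.
Proof. exact: (@val_Zp_nat M). Qed.

Lemma height_nat l : height (nat_of_ord l) = l.
Proof.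
by apply: ord_inj; rewrite /height -pmulrn val_nat modn_small //; exact: ltn_ord.
Qed.

Lemma val_height p : Posz (nat_of_ord (height p)) = (p %% M)%Z.
Proof.
rewrite {1}(divz_eq p M) /height intrD intrM.
have -> : ((M%:~R : 'I_M) = 0)%R.
  by apply: ord_inj; rewrite -pmulrn val_nat modnn.
rewrite mulr0 add0r; have : (0 <= (p %% M)%Z)%R by rewrite modz_ge0.
have : ((p %% M)%Z < M)%R by rewrite ltz_pmod.
case: (p %% M)%Z => // k ltk _.
by rewrite -pmulrn val_nat modn_small.
Qed.

(** The signed number of times that the edge [e], lifted to the integers, crosses
    a multiple of [M]. *)
Definition cut (e : I * 'I_M) : int := divz ((nat_of_ord e.2)%:Z + lam e.1) M.

Lemma cut_height i p : cut (i, height p) = (divz (p + lam i) M - divz p M)%R.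
Proof.
rewrite /cut val_height /=.
have -> : (p + lam i = divz p M * M + (modz p M + lam i))%R.
  by rewrite addrA -divz_eq.
by rewrite divzMDl // (addrC (divz p M)) addrK.
Qed.

Definition shift i : 'I_M := height (lam i).

Variable c : I * 'I_M -> int.

(** The exponents [c] will vanish near the cut, so that a short path sees powers of
    only one of the two letters and its label is computed in an abelian group. *)
Definition label (e : I * 'I_M) : L := expgz b (c e) * expgz a (cut e).

(** The crossings telescope along a path on which no edge carries a power of [b]. *)
Lemma label_near_cut w p :
    {in lift_word shift (height p) w, forall x, c x.1 = 0%R} ->
  eval label (lift_word shift (height p) w)
    = expgz a (divz (p + expsum lam w) M - divz p M)%R.
Proof.
elim: w p => [|[i [|]] w IH] p /= c0.
- by rewrite eval_nil expsum_nil addr0 subrr.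
- rewrite eval_cons /eval_letter /= expsum_cons /=.
  have cx : {in lift_word shift (height (p + lam i)%R) w, forall x, c x.1 = 0%R}.
    by move=> x xw; apply: c0; rewrite inE heightD xw orbT.
  rewrite heightD IH // {1}/label (c0 (i, _, true)) ?inE ?eqxx //= mul1g.
  rewrite cut_height -expgzD; congr expgz.
  by rewrite (addrA p); move: (divz _ M) (divz _ M) (divz _ M) => *; lia.
- rewrite eval_cons /eval_letter /= expsum_cons /=.
  have cx : {in lift_word shift (height (p - lam i)%R) w, forall x, c x.1 = 0%R}.
    by move=> x xw; apply: c0; rewrite inE heightV heightD xw orbT.
  rewrite heightV heightD IH // {1}/label.
  rewrite (c0 (i, _, false)) ?inE ?heightV ?heightD ?eqxx //= mul1g.
  rewrite cut_height -expgzN -expgzD; congr expgz.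
  by rewrite subrK (addrA p); move: (divz _ M) (divz _ M) (divz _ M) => *; lia.
Qed.

(** Each letter moves the height by at most [B], so a path that starts far enough
    from both ends of the interval from 0 to [M] never meets the cut. *)
Lemma label_far_from_cut w p (B : nat) : (forall i, `|lam i| <= B)%N ->
    (B%:Z * (size w)%:Z <= p)%R -> (p + B%:Z * (size w)%:Z < M)%R ->
  eval label (lift_word shift (height p) w)
    = expgz b (expsum c (lift_word shift (height p) w))
  /\ (0 <= p + expsum lam w < M)%R.
Proof.
move=> lamB.
have small (q : int) : (0 <= q < M)%R -> (q %/ M)%Z = 0%R.
  by move=> ?; rewrite divz_small.
elim: w p => [|[i s] w IH] p /= lop hip.
  by rewrite eval_nil !expsum_nil addr0; split=> //; lia.
have Bi := lamB i; move: lop hip; rewrite -addn1 PoszD mulrDr mulr1.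
set Bw := (B%:Z * _)%R in IH * => lop hip.
have Bw0 : (0 <= Bw)%R by rewrite /Bw; lia.
case: s; rewrite eval_cons !expsum_cons /eval_letter /=.
  have [|| IHp Hw] := IH (p + lam i)%R; [by lia | by lia |].
  rewrite heightD IHp /label cut_height !small; [| by lia | by lia].
  rewrite subr0 /= mulg1 -expgzD; split=> //.
  by move: Hw; rewrite addrA.
have [|| IHp Hw] := IH (p - lam i)%R; [by lia | by lia |].
rewrite heightV heightD IHp /label cut_height addrNK !small; [| by lia | by lia].
rewrite subr0 /= mulg1 -expgzN -expgzD; split=> //.
by move: Hw; rewrite addrA.
Qed.

End CyclicCover.

Hypotheses (ab_gen : forall z, exists w, z = eval ab w).
Hypothesis L_large : large L.

(** The theorem of Baumslag and Pride.  The group [K] is the subgroup of [L wr Z/M]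
    generated by the labelled generators.  Together with the relators one
    controls a word [u] of height 1, so that its [M]-th power has label [a] and
    its smaller powers lead to each vertex with trivial label. *)
Lemma deficiency_two_large (I : finType) (R : seq (seq (I * bool))) :
    (size R + 2 <= #|I|)%N ->
  exists (K : groupType) (f : I -> K),
    [/\ {in R, forall w, eval f w = 1}, (forall x, exists w, x = eval f w)
      & large K].
Proof.
move=> ltRI.
have [lam lamR [u lam_u]] : exists2 lam : I -> int,
    {in R, forall w, expsum lam w = 0%R} & exists u, expsum lam u = 1%R.
  by apply: primitive_solution; lia.
pose T := u :: R.
pose D := \sum_(w <- T) size w.
have sizeT w : w \in T -> (size w <= D)%N.
  by move=> wT; rewrite /D (big_rem w) //= leq_addr.
pose B0 := \sum_i `|lam i|%N.
have lamB0 i : (`|lam i| <= B0)%N by rewrite /B0 (bigD1 i) //= leq_addr.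
pose B := (B0 * D)%N.
(* A lift of a word of [T] travels at most [B] away from its origin.  At most [m]
   letters occur in the lifts that start in the zone of at most [2 * B] vertices
   near the cut, so a circle of length [m + 2] is long enough. *)
pose m := (2 * B * D)%N.
pose zone := [seq l : 'I_m.+2 <- enum 'I_m.+2 |
  (nat_of_ord l < B)%N || (m.+2 <= nat_of_ord l + B)%N].
have size_zone : (size zone <= 2 * B)%N.
  rewrite -(size_map (@nat_of_ord m.+2)).
  rewrite -[leqRHS](_ : size (iota 0 B ++ iota (m.+2 - B) B) = _).
    apply: uniq_leq_size => [|_ /mapP[l + ->]].
      by rewrite (map_inj_uniq (@ord_inj _)); apply/filter_uniq/enum_uniq.
    rewrite mem_filter mem_cat !mem_iota; have := ltn_ord l.
    by move=> ? /andP[? _] /=; lia.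
  by rewrite size_cat !size_iota; lia.
pose sh : I -> 'I_m.+2 := shift lam m.
have size_lift l w : size (lift_word sh l w) = size w.
  by elim: w l => [|[i []] w IH] l //=; rewrite IH.
(* Lifts have zero exponent sum, and single letters near the cut are killed. *)
pose E1 := [seq lift_word sh l w | w <- T, l <- enum 'I_m.+2].
pose E2 := [seq [:: x] | x <- flatten [seq lift_word sh l w | w <- T, l <- zone]].
have [c c0 [q cq]] : exists2 c : I * 'I_m.+2 -> int,
    {in E1 ++ E2, forall w, expsum c w = 0%R} & exists q, expsum c q = 1%R.
  apply: primitive_solution; rewrite size_cat size_map size_allpairs.
  rewrite size_enum_ord card_prod card_ord.
  have : (size (flatten [seq lift_word sh l w | w <- T, l <- zone]) <= m)%N.
    apply: (@leq_trans (\sum_(w <- T) \sum_(l <- zone) size w)).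
      rewrite size_flatten sumnE big_map big_allpairs_dep.
      by apply: leq_sum => w _; apply: leq_sum => l _; rewrite size_lift.
    under eq_bigr do rewrite big_const_seq count_predT iter_addn_0.
    by rewrite -big_distrl /= -/D mulnC leq_mul2r size_zone orbT.
  have : ((size R + 2) * m.+2 <= #|I| * m.+2)%N by rewrite leq_mul2r ltRI orbT.
  by rewrite /T /=; lia.
pose f := label lam c.
have c0_lift w l : w \in T -> expsum c (lift_word sh l w) = 0%R.
  move=> wT; apply: c0; rewrite mem_cat; apply/orP; left.
  by apply/allpairsP; exists (w, l); rewrite mem_enum.
have c0_zone w l : w \in T -> l \in zone ->
    {in lift_word sh l w, forall x, c x.1 = 0%R}.
  move=> wT lz [e s] xin; have : expsum c [:: (e, s)] = 0%R.
    apply: c0; rewrite mem_cat; apply/orP; right; apply/mapP; exists (e, s) => //.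
    apply/flattenP; exists (lift_word sh l w) => //.
    by apply/allpairsP; exists (w, l).
  rewrite expsum_cons expsum_nil addr0; case: s {xin} => //= /eqP.
  by rewrite oppr_eq0 => /eqP.
pose F := wreath_gen sh f.
have val_lt (l : 'I_m.+2) : (0 <= Posz (nat_of_ord l) < m.+2)%R.
  exact: (ltn_ord l).
have small (p : int) : (0 <= p < m.+2)%R -> divz p m.+2 = 0%R.
  by move=> ?; rewrite divz_small.
have div0 (l : 'I_m.+2) : divz (Posz (nat_of_ord l)) m.+2 = 0%R.
  exact/small/val_lt.
(* Near the cut only powers of [a] occur; far from it only powers of [b] do, and
   their exponents sum to zero. *)
have evalF1 w (l : 'I_m.+2) : w \in T ->
    (eval F w).1 l = expgz a (divz (Posz (nat_of_ord l) + expsum lam w) m.+2).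
  move=> wT; rewrite -eval_lift_word -{1}(height_nat l).
  have [lz|] := boolP (l \in zone).
    rewrite label_near_cut ?height_nat; last exact: c0_zone.
    by rewrite [X in (_ - X)%R]div0 ?subr0.
  rewrite mem_filter mem_enum andbT negb_or -leqNgt -ltnNge => /andP[lB Bl].
  have BT : (B0 * size w <= B)%N by rewrite leq_mul2l sizeT ?orbT.
  have [||-> Hw] := @label_far_from_cut I lam m c w (nat_of_ord l) B0 lamB0.
  - rewrite -PoszM lez_nat; exact: leq_trans BT lB.
  - rewrite -PoszM -PoszD ltz_nat; apply: leq_ltn_trans Bl; exact: leq_add.
  by rewrite height_nat c0_lift // small.
have eval_sh w : eval sh w = height m (expsum lam w).
  elim: w => [|[i s] w IH]; first by rewrite eval_nil expsum_nil.
  rewrite eval_cons IH expsum_cons /eval_letter /=.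
  by case: s; rewrite /sh /shift ?heightV heightD.
have FR w : w \in R -> eval F w = 1.
  move=> wR; have lam0 := lamR w wR; apply: wreath_eqP => [l|].
    by rewrite evalF1 ?inE ?wR ?orbT // lam0 addr0 div0 ?ffunE.
  by rewrite eval_wreath2 eval_sh lam0.
exists (subg_type (words_subgroup F)), (words_gen F); split=> [w wR||].
- by apply: val_inj; rewrite val_eval_words_gen FR.
- exact: words_genP.
pose incl : subg_type (words_subgroup F) -> wreath L 'I_m.+2 := val.
apply: (large_wreath (rho := incl)) => //.
pose S z := exists x, [/\ x \in words_subgroup F, x.2 = 1 & x.1 1 = z].
have S1 : S 1 by exists 1; split; rewrite ?gpred1 //= ffunE.
have SM y z : S y -> S z -> S (y * z).
  move=> [x [xF x2 <-]] [x' [x'F x'2 <-]]; exists (x * x'); split.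
  - exact: gpredM.
  - by rewrite wreath_mul2E x2 x'2 mulg1.
  - by rewrite wreath_mul1E x2 mulg1.
have SV z : S z -> S z^-1.
  move=> [x [xF x2 <-]]; exists x^-1; split.
  - by rewrite gpredV.
  - by rewrite /= x2 invg1.
  - by rewrite wreath_inv1E x2 mulgV.
have SX z n : S z -> S (expgz z n).
  have SXn k : S z -> S (z ^+ k).
    by move=> Sz; elim: k => [|k IH]; rewrite ?expg0 // expgS; apply: SM.
  by case: n => n Sz /=; [|apply: SV]; apply: SXn.
pose U := eval F u.
have U_gen n : U ^+ n \in words_subgroup F.
  by apply: gpredXn; apply/subgroup_ofP; exists u.
have UX2 n : (U ^+ n).2 = height m n.
  rewrite wreath_exp2E eval_wreath2 eval_sh lam_u.
  exact: zmodXgE.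
have UX1 n : (n < m.+2)%N -> (U ^+ n).1 1 = 1.
  elim: n => [|n IH] ltn; first by rewrite expg0 ffunE.
  rewrite expgSr wreath_mul1E IH ?mul1g 1?ltnW // UX2 evalF1 ?inE ?eqxx //.
  rewrite lam_u small // (val_height m n) modz_small; lia.
(* The power [u^M] goes once around the circle. *)
have Sa : S a.
  exists (U ^+ m.+2); split; first exact: U_gen.
    rewrite UX2; apply: ord_inj.
    by have := val_height m m.+2; rewrite modzz => -[].
  rewrite expgSr wreath_mul1E UX1 // mul1g UX2 evalF1 ?inE ?eqxx //.
  rewrite lam_u mul1g (val_height m m.+1) modz_small; last by lia.
  by rewrite -PoszD addn1 divzz.
(* Go to the edge along [u], cross it, and come back along [u]. *)
have Sb_c e : S (expgz b (c e)).
  case: e => i v; pose v' : 'I_m.+2 := v * sh i.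
  suff : S (f (i, v)).
    rewrite /f /label => Sf; rewrite -[expgz b _](mulgK (expgz a (cut lam (i, v)))).
    by apply: SM => //; apply/SV/SX.
  exists (U ^+ v * F i * (U ^+ v')^-1); split.
  - by rewrite gpredM ?gpredV ?gpredM ?U_gen // words_gen_in.
  - by rewrite !wreath_mul2E wreath_inv2E !UX2 !height_nat mulgV.
  - rewrite !wreath_mul1E wreath_inv1E wreath_mul2E !UX2 !height_nat /=.
    rewrite !mul1g mulgV (UX1 v) ?ltn_ord // mul1g ffunE.
    by rewrite (UX1 v' (ltn_ord v')) invg1 mulg1.
have Sb : S b.
  rewrite -[b]expgz1 -cq; elim: (q) => [|[e s] w IH]; first by rewrite expsum_nil.
  rewrite expsum_cons expgzD; apply: SM => //=.
  by case: s; rewrite ?expgzN; [|apply: SV]; apply: Sb_c.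
have Sz z : S z.
  have [w ->] := ab_gen z; elim: w => [|[i s] w IH]; first by rewrite eval_nil.
  rewrite eval_cons; apply: SM => //; rewrite /eval_letter /=.
  by case: s i => -[] //; apply: SV.
move=> z; have [x [xF x2 x1]] := Sz z.
by exists (Sub x xF); rewrite /incl SubK.
Qed.

End Presentation.

(** * Unipotent elements modulo D *)

Section Unipotent.
Local Open Scope ring_scope.

Section Ring.
Variables (R : nzRingType) (V : R).

Lemma expr1D_mod_square o : exists W, (1 + V) ^+ o = 1 + V *+ o + V ^+ 2 * W.
Proof.
elim: o => [|o [W IH]]; first by exists 0; rewrite expr0 mulr0n mulr0 !addr0.
exists (W + o%:R + V * W); rewrite exprS IH mulrDl mul1r !mulrDr mulr1.
have -> : V * (V *+ o) = V ^+ 2 * o%:R by rewrite !mulrnAr mulr1.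
have -> : V * (V ^+ 2 * W) = V ^+ 2 * (V * W) by rewrite expr2 -!mulrA.
by rewrite mulrSr -!addrA; congr (_ + (_ + _)); rewrite addrCA.
Qed.

(** [(1 + V)^o = 1] gives [o V = - V^2 W], and iterating multiplies by [o] each time
    the power of [V] rises. *)
Lemma unipotent_torsion o m :
  V ^+ m.+1 = 0 -> (1 + V) ^+ o = 1 -> V *+ (o ^ m) = 0.
Proof.
move=> V0 T1; have [W TW] := expr1D_mod_square o.
have VoW : V *+ o = V ^+ 2 * (- W).
  apply/eqP; rewrite mulrN -addr_eq0; apply/eqP.
  by apply: (addrI 1); rewrite addrA -TW T1 addr0.
have VoX k : V *+ (o ^ k) = V ^+ k.+1 * (- W) ^+ k.
  elim: k => [|k IH]; first by rewrite expn0 expr0 mulr1.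
  rewrite expnSr mulrnA IH -mulrnAl exprSr -mulrnAr VoW.
  by rewrite (mulrA (V ^+ k)) -exprD addn2 -mulrA -exprS.
by rewrite VoX V0 mul0r.
Qed.

Lemma unipotent_exp D n m : D%:R = 0 :> R -> V ^+ m.+1 = 0 ->
  (forall i, (0 < i <= m)%N -> (D %| 'C(n, i))%N) -> (1 + V) ^+ n = 1.
Proof.
move=> D0 V0 divD; rewrite exprDn_comm; last exact: commr_sym (commr1 V).
rewrite (bigD1 ord0) //= subn0 expr1n expr0 mulr1 bin0 mulr1n big1 ?addr0 //.
move=> [[|i] lti] //= _; rewrite expr1n mul1r.
have [lei|ltmi] := leqP i.+1 m.
  by have /dvdnP[q ->] := divD i.+1 lei; rewrite -mulr_natr natrM D0 !mulr0.
by rewrite -(subnKC ltmi) exprD V0 mul0r mul0rn.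
Qed.

End Ring.

(** [n] divides [i * C(n, i)], hence [m! * C(n, i)]; the part of [m!] prime to [D]
    is then cancelled. *)
Lemma dvdn_bin_factorial n m i :
  (0 < i <= m)%N -> (n %/ gcdn n m`! %| 'C(n, i))%N.
Proof.
case: i n => // i [|n] lei; first by rewrite bin0n.
set g := gcdn _ _; have g0 : (0 < g)%N by rewrite gcdn_gt0.
have ng : (n.+1 %/ g * g = n.+1)%N by rewrite divnK // dvdn_gcdl.
have mg : (m`! %/ g * g = m`!)%N by rewrite divnK // dvdn_gcdr.
have cop : coprime (n.+1 %/ g) (m`! %/ g).
  by rewrite /coprime -(eqn_pmul2r g0) muln_gcdl ng mg mul1n.
rewrite -(Gauss_dvdr _ cop) -(dvdn_pmul2r g0) ng mulnAC mg.
have dvdi : (i.+1 %| m`!)%N by apply: dvdn_fact.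
rewrite -(divnK dvdi) -mulnA -mul_bin_diag.
by rewrite mulnCA dvdn_mulr.
Qed.

Section UpperTriangular.
Variables (R : nzRingType) (m : nat).
Implicit Types A B : 'M[R]_m.+1.

Definition unitriangular A :=
  forall i j : 'I_m.+1, (j <= i)%N -> A i j = (i == j)%:R.

Lemma unitriangularM A B :
  unitriangular A -> unitriangular B -> unitriangular (A * B).
Proof.
move=> TA TB i j leji; rewrite mxE (bigD1 i) //= big1 ?addr0 => [|k nki].
  by rewrite TA // eqxx mul1r TB.
have [leki|ltik] := leqP k i; first by rewrite TA // eq_sym (negPf nki) mul0r.
have ltjk := leq_ltn_trans leji ltik.
by rewrite TB 1?ltnW // eq_sym -val_eqE (ltn_eqF ltjk) mulr0.
Qed.

Lemma unitriangular_nilpotent A : unitriangular A -> (A - 1) ^+ m.+1 = 0.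
Proof.
move=> TA; have VX k (i j : 'I_m.+1) : (j < i + k)%N -> ((A - 1) ^+ k) i j = 0.
  elim: k i j => [|k IH] i j ltj.
    by rewrite expr0 mxE -val_eqE gtn_eqF //; rewrite addn0 in ltj.
  rewrite exprS mxE big1 // => l _.
  have [leli|ltil] := leqP l i; last by rewrite IH ?mulr0 //; lia.
  by rewrite !mxE TA // subrr mul0r.
apply/matrixP => i j; rewrite VX ?mxE //.
exact: leq_trans (ltn_ord j) (leq_addl _ _).
Qed.

End UpperTriangular.

End Unipotent.

(** * Finite quotients of the free group of rank two *)

Lemma mulmxzE (R : nzRingType) m n (A : 'M[R]_(m, n)) (e : int) i j :
  ((A *~ e) i j = A i j *~ e)%R.
Proof.
case: e => k; first exact: mulmxnE.
by rewrite NegzE !mulrNz mxE -!pmulrn mulmxnE.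
Qed.

Section ResidualProperty.
Variables (L : groupType) (ab : bool -> L).

Definition syllables (s : seq (bool * int)) : L :=
  \prod_(x <- s) expgz (ab x.1) x.2.

Definition reduced (s : seq (bool * int)) :=
  sorted (fun x y => x.1 != y.1) s && all (fun x => x.2 != 0%R) s.

Lemma reduced_form w : exists2 s, reduced s & eval ab w = syllables s.
Proof.
have syl_cons x s : syllables (x :: s) = expgz (ab x.1) x.2 * syllables s.
  by rewrite /syllables big_cons.
have cons_reduced z e s : reduced s ->
    exists2 s', reduced s' & expgz (ab z) e * syllables s = syllables s'.
  move=> red_s; have [->|e0] := eqVneq e 0%R; first by exists s; rewrite ?mul1g.
  case: s red_s => [|[z' e'] s] red_s.
    by exists [:: (z, e)]; rewrite ?syl_cons // /reduced /= e0.
  have [zz'|zz'] := eqVneq z z'; last first.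
    exists ((z, e) :: (z', e') :: s); last by rewrite [RHS]syl_cons.
    by move: red_s; rewrite /reduced /= zz' e0.
  rewrite -zz' {z' zz'} in red_s *; rewrite syl_cons mulgA -expgzD /=.
  have red_tl : reduced s.
    by move: red_s; rewrite /reduced /= => /andP[/path_sorted-> /andP[_ ->]].
  have [->|ee0] := eqVneq (e + e')%R 0%R; first by exists s; rewrite ?mul1g.
  exists ((z, (e + e')%R) :: s); last by rewrite syl_cons.
  case: (s) red_s => [|y t]; rewrite /reduced /= ee0 //=.
  by move=> /andP[-> /andP[_ ->]].
elim: w => [|[z b] w [s red_s IH]].
  by exists [::] => //; rewrite eval_nil /syllables big_nil.
have [s' red_s' s'E] := cons_reduced z (if b then 1 else -1)%R s red_s.
exists s' => //; rewrite eval_cons IH -s'E.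
by case: b {s'E}; rewrite ?expgzN ?expgz1.
Qed.

Section Representation.
Local Open Scope ring_scope.
Variables (R : finComUnitRingType) (s : seq (bool * int)).
Hypothesis red_s : reduced s.
Notation m := (size s).
Implicit Types (z : bool) (e : int).

Let letter k := (nth (false, 0) s k).1.
Let expo k : int := (nth (false, 0) s k).2.

(** Letter [z] moves the [i]-th basis vector to the next one exactly when the
    [i]-th syllable of [s] is a power of [z]. *)
Definition step z : 'M[R]_m.+1 :=
  \matrix_(i, j) ((j == i.+1 :> nat) && (letter i == z))%:R.

(** Consecutive syllables of a reduced form are powers of different letters. *)
Lemma step_sqr z : step z * step z = 0.
Proof.
apply/matrixP => i k; rewrite !mxE big1 // => j _; rewrite !mxE.
have [ji|] := eqVneq (j : nat) i.+1; last by rewrite mul0r.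
have [kj|] := eqVneq (k : nat) j.+1; last by rewrite mulr0.
rewrite /= -natrM; case: eqP => [li|]; last by rewrite mul0n.
case: eqP => [lj|]; last by rewrite muln0.
have /andP[/(sortedP (false, 0))/(_ i)] := red_s.
have ltis : (i.+1 < m)%N by rewrite -ji -ltnS -kj.
by move=> /(_ ltis); rewrite -/(letter i) -/(letter i.+1) -ji li lj eqxx.
Qed.

Lemma step_unitP z : (1 + step z) * (1 - step z) = 1.
Proof.
rewrite mulrDl mul1r mulrBr mulr1 step_sqr subr0.
by rewrite addrNK.
Qed.

Fact step_unit z : 1 + step z \is a GRing.unit.
Proof.
apply/unitrP; exists (1 - step z); split; last exact: step_unitP.
rewrite mulrBl mul1r mulrDr mulr1 step_sqr addr0.
by rewrite addrK.
Qed.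

Definition step_gen z : {unit 'M[R]_m.+1} := FinRing.Unit (step_unit z).

Lemma val_step_expgz z e : val (expgz (step_gen z) e) = 1 + step z *~ e.
Proof.
have pow n : val (step_gen z ^+ n)%g = 1 + step z *+ n.
  elim: n => [|n IH]; first by rewrite expg0 mulr0n addr0.
  rewrite expgS val_unitM IH /= mulrDl mul1r mulrDr mulr1 mulrnAr step_sqr.
  by rewrite mul0rn addr0 mulrS -addrA [step z + _]addrC addrA.
case: e => n; first exact: pow.
apply: (mulrI (valP (step_gen z ^+ n.+1)%g)).
have -> : val (step_gen z ^+ n.+1)%g * val (expgz (step_gen z) (Negz n)) = 1.
  rewrite -val_unitM.
  have -> : (step_gen z ^+ n.+1 * expgz (step_gen z) (Negz n) = 1)%g.
    exact: mulgV.
  exact: val_unit1.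
rewrite pow NegzE mulrNz -pmulrn.
rewrite mulrBr mulr1 mulrDl mul1r mulrnAr mulrnAl step_sqr !mul0rn addr0.
by rewrite addrK.
Qed.

Lemma step_unitriangular z e : unitriangular (1 + step z *~ e).
Proof.
move=> i j leji; rewrite mxE mulmxzE !mxE.
by rewrite [j == _ :> nat]ltn_eqF // mul0rz addr0.
Qed.

(** Reading the first [k] syllables can reach position [k] from position 0 only by
    advancing at each syllable, which contributes the product of the exponents.
    The case [k = m] is the corner entry. *)
Lemma prefix_entry k (j : 'I_m.+1) : (k <= m)%N -> (k <= j)%N ->
  (\prod_(x <- take k s) (1 + step x.1 *~ x.2)) 0 j
    = if k == j then (\prod_(x <- take k s) x.2)%:~R else 0.
Proof.
elim: k j => [|k IH] j lekm lekj.
  by rewrite take0 !big_nil mxE mulr1z -val_eqE /=; case: eqP.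
rewrite (take_nth (false, 0)) // -cats1 !big_cat !big_seq1.
rewrite -/(letter k) -/(expo k) /=.
set P := \prod_(x <- _) _ in IH *; set e := \prod_(x <- _) _ in IH *.
have -> : (P * (1 + step (letter k) *~ expo k)) 0 j
    = P 0 j + (P * step (letter k)) 0 j *~ expo k.
  rewrite mulrDr mulr1 mxE; congr (_ + _); rewrite mulrzAr.
  exact: mulmxzE.
rewrite IH ?(ltnW lekm) ?(ltnW lekj) // (ltn_eqF lekj) add0r.
have ltkm : (k < m.+1)%N by exact: leq_trans lekm (leqnSn _).
have kE (l : 'I_m.+1) : (P 0 l) * (step (letter k)) l j
    = if (l == Ordinal ltkm) && (j == k.+1 :> nat) then e%:~R else 0.
  rewrite mxE; have [jl|jl] := eqVneq (j : nat) l.+1; last first.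
    rewrite mulr0; case: eqP => // lk; case: eqP => // jk.
    by rewrite jk lk eqxx in jl.
  rewrite IH ?(ltnW lekm) //; last by rewrite -ltnS -jl.
  rewrite jl eqSS -val_eqE /= [(l : nat) == k]eq_sym.
  by case: eqP => [<-|]; rewrite ?eqxx ?mulr1 ?mul0r.
rewrite mxE (eq_bigr _ (fun l _ => kE l)) (bigD1 (Ordinal ltkm)) //= eqxx /=.
rewrite big1 ?addr0 => [|l /negPf->] //.
rewrite [k.+1 == _]eq_sym; case: eqP => _; last by rewrite mul0rz.
by rewrite -mulrzA.
Qed.

End Representation.

Hypothesis ab_gen : forall z, exists w, z = eval ab w.
Hypothesis ab_free : forall (K : groupType) (f : bool -> K),
  exists2 phi : L -> K, {morph phi : x y / x * y} & forall i, phi (ab i) = f i.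

(** If the image of [g] has order [o], the corner entry of its unipotent part gives
    that [D] divides [C * o^m]; since [D] grows with [n], so does [o].  All images
    are unitriangular, so the exponent bound holds for every element, which lets
    several such quotients be combined. *)
Lemma finite_quotient_large_order (g : L) (k : nat) : g != 1 ->
  exists n0, forall n, (n0 <= n)%N ->
  exists (Q : finGroupType) (rho : L -> Q), [/\ {morph rho : x y / x * y},
    forall x, rho x ^+ n = 1 & forall o, (0 < o <= k)%N -> rho g ^+ o <> 1].
Proof.
move=> g1; have [w gw] := ab_gen g; have [s red_s sE] := reduced_form w.
pose m := size s; pose C := absz (\prod_(x <- s) x.2)%R.
have C0 : (0 < C)%N.
  rewrite absz_gt0 prodf_seq_neq0; apply/allP => x xs.
  by have /andP[_ /allP/(_ x xs)] := red_s.
pose B := (C * k ^ m)%N.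
exists (m`! * B.+1).+1 => n ltn.
pose D := (n %/ gcdn n m`!)%N.
have ltBD : (B.+1 < D)%N.
  rewrite -(ltn_pmul2l (fact_gt0 m)); apply: leq_trans ltn _.
  rewrite -[X in (X <= _)%N](divnK (dvdn_gcdl n m`!)) mulnC leq_mul2r.
  by rewrite dvdn_leq ?fact_gt0 ?dvdn_gcdr ?orbT.
have D1 : (1 < D)%N by apply: leq_ltn_trans ltBD.
pose R : finComUnitRingType := 'Z_D.
have R0 i : (i%:R == 0 :> R)%R = (D %| i)%N.
  by rewrite -val_eqE /= val_Zp_nat.
have Rz x : (x%:~R == 0 :> R)%R = (D %| absz x)%N.
  by case: x => i; rewrite ?NegzE ?mulrNz ?oppr_eq0 -pmulrn R0.
have [rho rhoM rhoE] := ab_free (step_gen R red_s).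
exists {unit 'M[R]_m.+1}, rho.
have rho_syl t :
    val (rho (syllables t)) = (\prod_(x <- t) (1 + step R s x.1 *~ x.2))%R.
  rewrite /syllables (big_morph rho rhoM (morph_one rhoM)).
  rewrite (big_morph _ (@val_unitM _) (val_unit1 _)); apply: eq_bigr => x _.
  by rewrite (expgz_morph _ _ rhoM) rhoE val_step_expgz.
have rho_g : val (rho g) = (\prod_(x <- s) (1 + step R s x.1 *~ x.2))%R.
  by rewrite gw sE rho_syl.
have nilp x : ((val (rho x) - 1) ^+ m.+1 = 0)%R.
  have [u ->] := ab_gen x; have [t _ ->] := reduced_form u.
  apply: unitriangular_nilpotent; rewrite rho_syl.
  apply: big_ind => [i j _||y _]; last exact: step_unitriangular.
    by rewrite mxE.
  exact: unitriangularM.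
pose V := (val (rho g) - 1)%R.
have VE x : val (rho x) = (1 + (val (rho x) - 1))%R by rewrite addrC subrK.
split=> // [x|o /andP[o0 ok] rho_o].
  apply: val_inj; rewrite val_unitX VE.
  apply: (unipotent_exp (D := D) _ (nilp x)) => [|i im];
    last exact: dvdn_bin_factorial.
  apply/matrixP => i j; rewrite mulmxnE -mulr_natr.
  by have /eqP-> : (D%:R == 0 :> R)%R; rewrite ?R0 // mulr0 mxE.
have : (V *+ (o ^ m) = 0)%R.
  apply: (unipotent_torsion (nilp g)); rewrite -VE -val_unitX rho_o.
  exact: val_unit1.
have m0 : (0 < m)%N.
  rewrite lt0n; apply: contra g1 => /eqP/size0nil s0.
  by rewrite gw sE s0 /syllables big_nil.
move=> /matrixP/(_ 0%R ord_max)/eqP.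
have -> : (V *+ (o ^ m))%R 0%R ord_max
    = ((\prod_(x <- s) x.2)%R * (o ^ m)%:Z)%:~R%R.
  have := @prefix_entry R s m ord_max (leqnn m) (leqnn m).
  rewrite take_size eqxx -rho_g mulmxnE [V _ _]mxE => ->.
  rewrite !mxE -val_eqE /= ltn_eqF // subr0.
  by rewrite intrM -pmulrn mulr_natr.
rewrite mxE Rz abszM => /dvdn_leq.
rewrite muln_gt0 C0 expn_gt0 o0 => /(_ isT); apply/negP; rewrite -ltnNge.
apply: leq_ltn_trans (ltnW ltBD); rewrite leq_mul2l.
by rewrite leq_exp2r ?ok ?orbT.
Qed.

End ResidualProperty.

(** Replaces [Q] by the image of [rho] with its own group structure, so that a
    vertex of the Cayley graph is always reached by a path from 1. *)
Lemma onto_finite_image (G : groupType) (Q : finGroupType) (rho : G -> Q) :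
    {morph rho : x y / x * y} ->
  exists (Q' : finGroupType) (rho' : G -> Q'), [/\ {morph rho' : x y / x * y},
    forall v, exists x, rho' x = v
    & forall x n, rho' x ^+ n = 1 <-> rho x ^+ n = 1].
Proof.
move=> rhoM; pose A := [set v : Q | `[< exists x, rho x = v >]]%SET.
have A_group : group_set A.
  apply/group_setP; split=> [|u v].
    by rewrite finset.in_set; apply/asboolP; exists 1; apply: morph_one.
  rewrite !finset.in_set => /asboolP[x <-] /asboolP[y <-].
  by apply/asboolP; exists (x * y); rewrite rhoM.
pose H := Group A_group.
have inH x : rho x \in H by rewrite finset.in_set; apply/asboolP; exists x.
pose rho' x : subg_of H := Subg (inH x).
have rho'M : {morph rho' : x y / x * y}.
  by move=> x y; apply: val_inj; rewrite /= rhoM.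
exists (subg_of H), rho'; split=> // [[v Hv]|x n].
  have := Hv; rewrite finset.in_set => /asboolP[x xv].
  by exists x; apply: val_inj.
rewrite -(morph_exp rho'M) -(morph_exp rhoM); split=> [/(congr1 val)|xn1] //.
by apply: val_inj; rewrite /= xn1.
Qed.

Section FreeTwo.
Variables (L : groupType) (ab : bool -> L).
Hypothesis ab_gen : forall z, exists w, z = eval ab w.
Hypothesis ab_free : forall (K : groupType) (f : bool -> K),
  exists2 phi : L -> K, {morph phi : x y / x * y} & forall i, phi (ab i) = f i.
Hypothesis L_large : large L.

Lemma finite_quotient_large_orders (gs : seq L) k : all (fun g => g != 1) gs ->
  exists n0, forall n, (n0 <= n)%N ->
  exists (Q : finGroupType) (rho : L -> Q), [/\ {morph rho : x y / x * y},
    forall x, rho x ^+ n = 1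
  & {in gs, forall g o, (0 < o <= k)%N -> rho g ^+ o <> 1}].
Proof.
elim: gs => [_|g gs IH /= /andP[g1 /IH[n1 Hn1]]].
  exists 0 => n _; exists 'I_1, (fun=> 1); split=> // [x y|x].
    by rewrite mulg1.
  by rewrite expg1n.
have [n2 Hn2] := finite_quotient_large_order ab_gen ab_free k g1.
exists (maxn n1 n2) => n; rewrite geq_max => /andP[/Hn1 H1 /Hn2 H2].
have [Q1 [rho1 [rho1M rho1n rho1k]]] := H1.
have [Q2 [rho2 [rho2M rho2n rho2k]]] := H2.
pose rho x : Q1 * Q2 := (rho1 x, rho2 x).
have rhoM : {morph rho : x y / x * y} by move=> x y; rewrite /rho rho1M rho2M.
have rhoX x o : rho x ^+ o = (rho1 x ^+ o, rho2 x ^+ o).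
  by rewrite -(morph_exp rhoM) /rho (morph_exp rho1M) (morph_exp rho2M).
exists (Q1 * Q2)%type, rho; split=> // [x|h]; first by rewrite rhoX rho1n rho2n.
rewrite in_cons => /orP[/eqP->|hs] o.
  by move=> /rho2k + oo; rewrite rhoX in oo; case: oo.
by move=> /(rho1k _ hs) + oo; rewrite rhoX in oo; case: oo.
Qed.

(** The edges of the Cayley graph of a finite quotient [Q] of [L] are the generators
    of a presentation with relators for the chosen paths from 1 and for the powers
    of the elements of [gs], and its deficiency is at least two.  Labelling the
    edges by the generators of the resulting large group defines [Phi]. *)
Lemma powers_killed_onto_large (gs : seq L) : all (fun g => g != 1) gs ->
  exists n0, forall n, (n0 <= n)%N ->
  exists (K : groupType) (Q : finGroupType) (Phi : L -> wreath K Q),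
    [/\ {morph Phi : x y / x * y},
        forall z, exists x, (Phi x).2 = 1 /\ (Phi x).1 1 = z,
        large K
      & {in gs, forall g, Phi g ^+ n = 1}].
Proof.
move=> gs1; pose k := (2 * size gs)%N.
have [n0 Hn0] := finite_quotient_large_orders k gs1; exists n0 => n /Hn0.
move=> [Q0 [rho0 [rho0M rho0n rho0k]]].
have [Q [rho [rhoM rho_onto rhoX]]] := onto_finite_image rho0M.
have rho_n x : rho x ^+ n = 1 by apply/rhoX.
have rho_order g : g \in gs -> (k < #[rho g])%N.
  move=> ggs; rewrite ltnNge; apply/negP => lek.
  apply: (rho0k g ggs #[rho g]%g); first by rewrite order_gt0.
  by apply/rhoX; exact: expg_order.
pose sg i := rho (ab i).
have eval_sg w : eval sg w = rho (eval ab w) by rewrite (eval_morph _ _ rhoM).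
have [path pathE] : {path : Q -> seq (bool * bool) &
    forall v, (v = 1 -> path v = [::]) /\ eval sg (path v) = v}.
  apply: (@choice _ _ (fun v w => (v = 1 -> w = [::]) /\ eval sg w = v)) => v.
  have [->|v1] := eqVneq v 1.
    by exists [::]; rewrite eval_nil.
  have [x xv] := rho_onto v; have [w xw] := ab_gen x.
  exists w; split; last by rewrite eval_sg -xw.
  by move=> /eqP; rewrite (negPf v1).
have [word wordE] : {word : L -> seq (bool * bool) &
    forall x, eval ab (word x) = x}.
  apply: (@choice _ _ (fun x w => eval ab w = x)) => x.
  by have [w ->] := ab_gen x; exists w.
pose relT := [seq lift_word sg 1 (path v) | v <- rem 1 (enum Q)].
pose relG := [seq lift_word sg (repr C) (flatten (nseq n (word g)))
             | g <- gs, C <- enum (lcosets <[rho g]> [set: Q]%SET)].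
(* An element of order more than [k] has at most [#|Q| / k.+1] cosets. *)
have size_relG : (size relG < #|Q|)%N.
  have le_relG : (k.+1 * size relG <= size gs * #|Q|)%N.
    rewrite size_allpairs_dep sumnE big_map big_distrr /=.
    apply: (@leq_trans (\sum_(g <- gs) #|Q|)); last first.
      by rewrite big_const_seq count_predT iter_addn_0 mulnC.
    rewrite big_seq [X in (_ <= X)%N]big_seq; apply: leq_sum => g ggs.
    rewrite -cardE card_lcosets -cardsT -(Lagrange (finset.subsetT <[rho g]>)).
    by rewrite leq_mul2r (rho_order g ggs) orbT.
  have card_Q : (0 < #|Q|)%N by rewrite -cardsT cardG_gt0.
  rewrite ltnNge; apply/negP => leQ.
  have := leq_trans (leq_mul (leqnn k.+1) leQ) le_relG.
  by rewrite leq_pmul2r // /k; lia.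
have size_rel : (size (relT ++ relG) + 2 <= #|{: bool * Q}|)%N.
  have -> : #|{: bool * Q}| = (2 * #|Q|)%N by rewrite card_prod card_bool.
  have size_relT : size relT = #|Q|.-1.
    by rewrite size_map size_rem ?mem_enum -?cardE.
  by rewrite size_cat size_relT; move: size_relG; lia.
have [K [f [fR f_gen K_large]]] := deficiency_two_large ab_gen L_large size_rel.
have [Phi PhiM PhiE] := ab_free (wreath_gen sg f).
have Phi_eval w : Phi (eval ab w) = eval (wreath_gen sg f) w.
  rewrite (eval_morph _ _ PhiM); exact: eval_ext.
have Phi2 x : (Phi x).2 = rho x.
  by have [w ->] := ab_gen x; rewrite Phi_eval eval_wreath2 eval_sg.
have Phi_path v : (Phi (eval ab (path v))).1 1 = 1.
  rewrite Phi_eval -eval_lift_word; have [v1|v1] := eqVneq v 1.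
    by have [path1 _] := pathE v; rewrite path1 ?eval_nil.
  apply: fR; rewrite mem_cat; apply/orP; left; apply: map_f.
  by rewrite mem_rem_uniq ?enum_uniq // [_ \in _]andbC mem_enum.
have path_rho v : rho (eval ab (path v)) = v by rewrite -eval_sg; case: (pathE v).
exists K, Q, Phi; split=> // [z|g ggs].
  pose S z := exists x, (Phi x).2 = 1 /\ (Phi x).1 1 = z.
  have SM y y' : S y -> S y' -> S (y * y').
    move=> [x [x2 <-]] [x' [x'2 <-]]; exists (x * x'); rewrite PhiM; split.
      by rewrite wreath_mul2E x2 x'2 mulg1.
    by rewrite wreath_mul1E x2 mulg1.
  have SV y : S y -> S y^-1.
    move=> [x [x2 <-]]; exists x^-1; rewrite (morph_inv PhiM); split.
      by rewrite wreath_inv2E x2 invg1.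
    by rewrite wreath_inv1E x2 mulgV.
  have Sf e : S (f e).
    case: e => i v; pose v' := v * sg i.
    exists (eval ab (path v) * ab i * (eval ab (path v'))^-1).
    rewrite !PhiM (morph_inv PhiM); split.
      by rewrite !wreath_mul2E wreath_inv2E !Phi2 !path_rho mulgV.
    rewrite !wreath_mul1E wreath_inv1E wreath_mul2E !Phi2 !path_rho !mul1g.
    by rewrite mulgV !Phi_path PhiE ffunE invg1 mul1g mulg1.
  have [w ->] := f_gen z; elim: w => [|[e s] w IH].
    exists 1; rewrite (morph_one PhiM) eval_nil; split=> //.
    by rewrite ffunE.
  rewrite eval_cons; apply: SM => //; rewrite /eval_letter /=.
  by case: s; [|apply: SV]; apply: Sf.
have PhiX : Phi g ^+ n = Phi (g ^+ n) by rewrite (morph_exp PhiM).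
have Phi_n2 : (Phi g ^+ n).2 = 1 by rewrite PhiX Phi2 (morph_exp rhoM) rho_n.
apply: wreath_eqP => [v|]; last exact: Phi_n2.
pose C := v *: <[rho g]>.
have Crep : repr C \in C by apply: (mem_repr v); exact: lcoset_refl.
have [i repE] : exists i, repr C = v * rho g ^+ i.
  have /lcosetP[u /cycleP[i ->] ->] := Crep.
  by exists i.
have rel_rep : (Phi g ^+ n).1 (repr C) = 1.
  rewrite -[g in Phi g]wordE Phi_eval -eval_nseq -eval_lift_word; apply: fR.
  rewrite mem_cat; apply/orP; right; apply/allpairsPdep; exists g, C; split=> //.
  by rewrite mem_enum; apply/lcosetsP; exists v.
(* [Phi g] commutes with its power, so a relator at one vertex of the coset gives
   the relator at every other. *)
have comm : Phi g ^+ i * Phi g ^+ n = Phi g ^+ n * Phi g ^+ i.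
  by rewrite -!expgnDr addnC.
have /= := congr1 (fun x : wreath K Q => x.1 v) comm.
rewrite !wreath_mul1E Phi_n2 mulg1 wreath_exp2E Phi2 -repE rel_rep mulg1.
by move=> e; rewrite ffunE; apply: (mulIg ((Phi g ^+ i).1 v)); rewrite mul1g.
Qed.

End FreeTwo.

(** * Reduction to rank two *)

Lemma quotg_lift (G K : groupType) (S : set G) (psi : G -> K) :
    {morph psi : x y / x * y} -> (forall s, S s -> psi s = 1) ->
  exists2 rho : quotg (normal_closure S) -> K, {morph rho : x y / x * y}
    & forall x, rho (quotg_pi (normal_closure S) x) = psi x.
Proof.
move=> psiM psiS.
have k1 : psi 1 = 1 by apply: morph_one.
have kM x y : psi x = 1 -> psi y = 1 -> psi (x * y) = 1.
  by rewrite psiM => -> ->; rewrite mulg1.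
have kV x : psi x = 1 -> psi x^-1 = 1.
  by rewrite morph_inv // => ->; rewrite invg1.
have ncl_ker x : x \in ncl S -> psi x = 1.
  move=> /nclP/(_ (subgroup_of k1 kM kV)) xker; apply/(subgroup_ofP k1 kM kV).
  apply: xker => [y z /subgroup_ofP y1|s /psiS s1]; apply/subgroup_ofP => //.
  by rewrite /conjg !psiM (morph_inv psiM) y1 mul1g mulVg.
have psi_pi x y : quotg_pi (normal_closure S) x = quotg_pi (normal_closure S) y ->
    psi x = psi y.
  move=> /quotg_piP/ncl_ker; rewrite psiM (morph_inv psiM) => xy.
  by apply: (mulgI (psi x)^-1); rewrite mulVg.
pose rho (q : quotg (normal_closure S)) := psi (generic_quotient.repr q).
have rhoE x : rho (quotg_pi _ x) = psi x.
  by apply: psi_pi; rewrite /quotg_pi generic_quotient.reprK.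
exists rho => // p q.
have piE (u : quotg (normal_closure S)) : quotg_pi _ (generic_quotient.repr u) = u.
  by rewrite /quotg_pi generic_quotient.reprK.
by rewrite -(piE p) -(piE q) -quotg_piM !rhoE psiM.
Qed.

(** If the elements of the basis commute, conjugation by a basis element fixes the
    basis, so it is the identity and the basis is central; then conjugation by any
    element fixes the basis. *)
Lemma free_noncommuting (F : groupType) (X : set F) :
    free_on X -> ~ abelian_group F ->
  exists x y, [/\ X x, X y & x * y <> y * x].
Proof.
move=> X_free F_nab; apply: contrapT => no_xy; apply: F_nab.
have X_comm x y : X x -> X y -> x * y = y * x.
  by move=> Xx Xy; apply: contrapT => nxy; apply: no_xy; exists x, y.
have conj_id z : (forall x, X x -> x ^ z = x) -> forall y, y ^ z = y.
  move=> zX; have [_ uniq] := X_free F id.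
  have [psi psiE] := morph_pack (fun u v => conjMg u v z).
  have [phi phiE] := morph_pack (phi := @id F) (fun _ _ => erefl).
  move=> y; rewrite -psiE -[RHS]phiE; apply: uniq => x /set_mem Xx /=.
    by rewrite psiE zX.
  by rewrite phiE.
have conj_comm (u v : F) : u ^ v = u -> u * v = v * u.
  by move=> uv; rewrite conjgC uv.
have X_central x y : X x -> y * x = x * y.
  move=> Xx; apply: conj_comm; apply: conj_id => z Xz.
  by rewrite /conjg (X_comm z x) // mulKg.
move=> y z; apply: conj_comm; apply: conj_id => x Xx.
by rewrite /conjg -(X_central x) // mulKg.
Qed.

(** The subgroup generated by two noncommuting basis elements is free on them: the
    homomorphisms needed are restrictions from [F]. *)
Section TwoGeneratorRetract.
Variables (F : groupType) (X : set F) (xy : bool -> F).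
Hypotheses (X_free : free_on X) (xyX : forall i, X (xy i)).
Hypothesis xy_nc : xy true * xy false <> xy false * xy true.

Let L : groupType := subg_type (words_subgroup xy).
Let ab : bool -> L := words_gen xy.

Lemma extend_two (K : groupType) (f : bool -> K) :
  exists2 phi : F -> K, {morph phi : x y / x * y} & forall i, phi (xy i) = f i.
Proof.
have [[phi phiE] _] := X_free (fun z => if z == xy true then f true else f false).
exists phi; first exact: gmulfM.
have xy' : xy false == xy true = false by apply/eqP => e; apply: xy_nc; rewrite e.
by case; rewrite phiE ?inE //= ?eqxx ?xy'.
Qed.

Lemma two_gen_free (K : groupType) (f : bool -> K) :
  exists2 phi : L -> K, {morph phi : x y / x * y} & forall i, phi (ab i) = f i.
Proof.
have [phi phiM phiE] := extend_two f.
exists (fun x => phi (val x)) => [x y|i]; last exact: phiE.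
by rewrite -phiM; congr phi; apply: subg_valM.
Qed.

Lemma two_gen_large : large L.
Proof.
apply: free_large.
  exists (range ab) => K f; split.
    have [phi phiM phiE] := two_gen_free (f \o ab).
    have [psi psiE] := morph_pack phiM.
    by exists psi => x /set_mem[i _ <-]; rewrite psiE phiE.
  move=> phi psi phiE psiE x; have [w ->] := words_genP x.
  rewrite (eval_morph _ _ (@gmulfM _ _ phi)) (eval_morph _ _ (@gmulfM _ _ psi)).
  have abX i : ab i \in range ab by apply/mem_set; exists i.
  by apply: eval_ext => i /=; rewrite phiE ?psiE.
by move=> /(_ (ab true) (ab false)) /(congr1 val).
Qed.

(** The other basis elements may be sent anywhere, which gives a map from [F] onto
    the subgroup. *)
Lemma large_quotient_by_powers (r : nat) (g : 'I_r -> F) :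
  exists n0, forall n : int, (n0 <= absz n)%N ->
    large (quotg (normal_closure (range (fun i => expgz (g i) n)))).
Proof.
have [pr prM prE] := extend_two ab.
have ab_gen (z : L) : exists w, z = eval ab w by exact: words_genP.
pose gs := [seq g' <- [seq pr (g i) | i <- enum 'I_r] | g' != 1].
have gs1 : all (fun h => h != 1) gs by exact: filter_all.
have [n0 Hn0] := powers_killed_onto_large ab_gen two_gen_free two_gen_large gs1.
exists n0 => n /Hn0[K [Q [Phi [PhiM Phi_onto K_large Phi_gs]]]].
pose S := range (fun i => expgz (g i) n).
have [|s [i _ <-] /=|rho rhoM rhoE] := @quotg_lift F (wreath K Q) S (Phi \o pr).
- by move=> u v; rewrite /= prM PhiM.
- rewrite (expgz_morph _ _ prM) (expgz_morph _ _ PhiM); apply/expgz_abs.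
  have [->|gi1] := eqVneq (pr (g i)) 1; first by rewrite (morph_one PhiM) expg1n.
  by apply: Phi_gs; rewrite mem_filter gi1 /=; apply: map_f; rewrite mem_enum.
apply: (large_wreath rhoM) K_large => z.
have [x xz] := Phi_onto z; have [w xw] := ab_gen x.
exists (quotg_pi _ (eval xy w)); rewrite rhoE /= (eval_morph _ _ prM).
by have -> : eval (pr \o xy) w = x by rewrite xw; exact: eval_ext.
Qed.

End TwoGeneratorRetract.

Unset Implicit Arguments.

Theorem theorem1p2 (F : groupType) (F_fg : finitely_generated F)
    (F_free : free_group F) (F_nonab : ~ abelian_group F)
    (r : nat) (g : 'I_r -> F) :
  finite_set [set n : int |
    ~ large (quotg (normal_closure (range (fun i => expgz (g i) n))))].
Proof.
have [X X_free] := F_free.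
have [x [y [Xx Xy xy_nc]]] := free_noncommuting X_free F_nonab.
pose xy (i : bool) := if i then x else y.
have [|n0 Hn0] := @large_quotient_by_powers F X xy X_free _ xy_nc r g; first by case.
pose neg k : int := (- Posz k)%R.
apply: (sub_finite_set (B := (Posz @` `I_n0) `|` (neg @` `I_n0))).
  move=> n nlarge; have ltn : (absz n < n0)%N.
    by rewrite ltnNge; apply/negP => /Hn0.
  case: n ltn {nlarge} => k ltk; first by left; exists k.
  by right; exists k.+1; rewrite // /neg NegzE.
by rewrite finite_setU; split; apply: finite_image; apply: finite_II.
Qed.
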